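(* Let $H$ be a real Hilbert space, $C\subseteq H$ a closed convex set, and $A\colon H\to H$ a mapping such that: (C1) the solution set $S=\{x^*\in C : (Ax^*,x-x^* )\ge 0 \ \ \forall x\in C\}$ is nonempty; (C2) $(Ax-Ay,x-y)\ge 0$ for all $x,y\in C$; (C3) there is a constant $L>0$ with $\|Ax-Ay\|\le L\|x-y\|$ for all $x,y\in C$. Let $\lambda\in\left(0,\frac{1}{2L}\right)$ and $k>\frac{1}{1-2\lambda L}$. Then, for any $x_0,z_0\in C$, the (infinite) sequences $(x_n)$ and $(z_n)$ generated by the Hybrid algorithm without extrapolation step (described in the context) with these parameters $\lambda,k$ both converge strongly (in norm) to $P_S x_0$.
   Context: $(\cdot,\cdot)$ and $\|\cdot\|$ denote the inner product and norm of $H$, and $P_M$ denotes the metric projection onto a nonempty closed convex set $M\subseteq H$. The set $S$ is closed and convex. Hybrid algorithm without extrapolation step: 1. Choose $x_0,z_0\in C$ and two parameters $k>0$ and $\lambda>0$. Set $n=0$. 2. Given the current iterates $x_n$ and $z_n$, compute $$z_{n+1}=P_C(x_n-\lambda Az_n).$$ If $z_{n+1}=x_n=z_n$ then stop. Otherwise construct the sets $C_n$ and $Q_n$ by $C_0=H$, $Q_0=H$, and, for $n\ge 1$, $$C_n=\Bigl\{w\in H : \|z_{n+1}-w\|^2\le \|x_n-w\|^2+k\|x_n-x_{n-1}\|^2-\bigl(1-\tfrac1k-\lambda L\bigr)\|z_{n+1}-z_n\|^2+\lambda L\|z_n-z_{n-1}\|^2\Bigr\},$$ $$Q_n=\{w\in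 H : (x_n-w,\,x_0-x_n)\ge 0\},$$ and compute $$x_{n+1}=P_{C_n\cap Q_n}x_0.$$ 3. Replace $n$ by $n+1$ and return to step 2. Here $L$ is the Lipschitz constant from (C3). The sequences are infinite when the stopping criterion is never met. *)

(* Defs.v *)
From HB Require Import structures.
From mathcomp Require Export all_boot all_order all_algebra.
From mathcomp Require Export boolp classical_sets reals.
From mathcomp Require Export topology normedtype sequences convex.

Set Implicit Arguments.
Unset Strict Implicit.
Unset Printing Implicit Defensive.

Export Order.TTheory GRing.Theory Num.Theory.
Export numFieldNormedType.Exports.

Local Open Scope classical_set_scope.
Local Open Scope ring_scope.

(* A real Hilbert space is a complete normed module [H] over the reals together
   with an inner product [ip : {dot H for idfun}] (a symmetric positive definite
   bilinear form) that induces the norm of [H]. *)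
Definition induces_norm (R : realType) (H : completeNormedModType R)
    (ip : {dot H for idfun}) : Prop :=
  forall u : H, `|u| = Num.sqrt (ip u u).

Definition is_nearest_point (R : realType) (H : completeNormedModType R)
    (M : set H) (x p : H) : Prop :=
  M p /\ forall y, M y -> `|x - p| <= `|x - y|.

(* The value is the unique nearest point when [M] is nonempty, closed and
   convex; the default [x] is only returned when no nearest point exists. *)
Definition metric_proj (R : realType) (H : completeNormedModType R)
    (M : set H) (x : H) : H :=
  xget x (is_nearest_point M x).

Definition vi_solutions (R : realType) (H : completeNormedModType R)
    (ip : {dot H for idfun}) (C : set H) (A : H -> H) : set H :=
  [set x | C x /\ forall y, C y -> 0 <= ip (A x) (y - x)].

Definition hybrid_C (R : realType) (H : completeNormedModType R)
    (L lambda k : R) (x z : nat -> H) (n : nat) : set H :=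
  if n is m.+1 then
    [set w | `|z n.+1 - w| ^+ 2 <=
       `|x n - w| ^+ 2 + k * `|x n - x m| ^+ 2
       - (1 - 1 / k - lambda * L) * `|z n.+1 - z n| ^+ 2
       + lambda * L * `|z n - z m| ^+ 2]
  else setT.

Definition hybrid_Q (R : realType) (H : completeNormedModType R)
    (ip : {dot H for idfun}) (x : nat -> H) (n : nat) : set H :=
  if n is _.+1 then [set w | 0 <= ip (x n - w) (x 0%N - x n)] else setT.

(* An infinite run: the stopping test [z_{n+1} = x_n = z_n] fails at every
   step.  [z n.+1] is computed before [x n.+1], so [hybrid_C _ _ _ x z n] only
   refers to iterates that are already available. *)
Record hybrid_run (R : realType) (H : completeNormedModType R)
    (ip : {dot H for idfun}) (C : set H) (A : H -> H) (L lambda k : R)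
    (x0 z0 : H) (x z : nat -> H) : Prop := HybridRun {
  run_x0 : x 0%N = x0;
  run_z0 : z 0%N = z0;
  run_z : forall n, z n.+1 = metric_proj C (x n - lambda *: A (z n));
  run_continues : forall n, ~ (z n.+1 = x n /\ x n = z n);
  run_x : forall n, x n.+1 =
    metric_proj (hybrid_C L lambda k x z n `&` hybrid_Q ip x n) x0
}.

(* Main.v *)
From mathcomp Require Import ring lra interval_inference.
Require Import Defs.
Set Implicit Arguments.
Unset Strict Implicit.
Unset Printing Implicit Defensive.
Local Open Scope classical_set_scope.
Local Open Scope ring_scope.

(** The cuts [hybrid_C] and [hybrid_Q] are half-spaces that always contain the
    solution set S of the variational inequality. For [hybrid_C] this is the
    step estimate [projection_step_estimate], which compares two consecutive
    projection steps; for [hybrid_Q] it is the obtuse angle at a projection.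

    Since x_(n+1) is the projection of x_0 on their intersection, the distances
    from x_n to x_0 increase and stay below the distance from x_0 to S.
    Membership of x_(n+1) in [hybrid_C] then makes an energy built from these distances and
    from the squared increments of z decrease by at least a multiple of
    |z_(n+1) - z_n|^2 + |z_(n+1) - x_(n+1)|^2 at each step, so that both
    differences tend to 0 ([run_increments_cvg0]).

    Let p be the projection of x_0 on S. The distance bound gives
    |x_n - p|^2 <= 2 (x_n - p, x_0 - p), so strong convergence reduces to
    limsup (z_n - p, x_0 - p) <= 0, which is a weak-limit argument. Instead of
    the weak topology, it uses a point lying in every closed convex set that
    contains the selected terms of the sequence from some rank on
    ([weak_cluster_point]). Such a point exists because nested closed convex
    sets at bounded distance from a point meet ([nested_convex_closest], the
    parallelogram argument that also gives the projection theorem). In Minty's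
    form, the variational inequality at a point is a family of half-space
    conditions; the z_n satisfy each of them up to an error tending to 0, so
    every such cluster point solves the inequality. Its angle with x_0 at p is
    then obtuse, which is the required limsup bound. *)

(** * Convex sets and the inner product *)

Lemma convex_setP (R : realType) (H : completeNormedModType R) (M : set H) :
  convex_set (M : set (convex_lmodType H)) <->
  forall u v (t : R), 0 <= t -> t <= 1 -> M u -> M v ->
    M (t *: u + (1 - t) *: v).
Proof.
split=> [cM u v t t0 t1 Mu Mv|cM u v t].
  have := cM u v (Itv01 t0 t1).
  by rewrite !inE => /(_ Mu Mv).
rewrite !inE => Mu Mv; apply: cM => //.
Qed.

Section InnerProduct.
Context (R : realType) (H : completeNormedModType R).
Context (ip : {dot H for idfun}) (ip_norm : induces_norm ip).

Lemma ipC u v : ip u v = ip v u.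
Proof. by rewrite hermC expr0 mul1r. Qed.

Lemma sqr_norm u : `|u| ^+ 2 = ip u u.
Proof.
rewrite ip_norm sqr_sqrtr //.
have [->|u0] := eqVneq u 0; first by rewrite linear0l.
exact/ltW/neq0_dnorm_gt0.
Qed.

Lemma sqr_normD u v : `|u + v| ^+ 2 = `|u| ^+ 2 + `|v| ^+ 2 + 2 * ip u v.
Proof. by rewrite !sqr_norm hnormD expr0 /= mul1r mulr_natl mulr2n. Qed.

Lemma sqr_normB u v : `|u - v| ^+ 2 = `|u| ^+ 2 + `|v| ^+ 2 - 2 * ip u v.
Proof. by rewrite sqr_normD normrN linearNr mulrN. Qed.

(** Expresses [ip] through norms, so that its joint continuity follows from that
    of the norm. *)
Lemma polarization u v : ip u v = (`|u + v| ^+ 2 - `|u - v| ^+ 2) / 4.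
Proof. rewrite sqr_normD sqr_normB; lra. Qed.

Lemma young (a : R) u v : 0 < a ->
  2 * ip u v <= a * `|u| ^+ 2 + a^-1 * `|v| ^+ 2.
Proof.
move=> a0; rewrite -(ler_pM2l a0) mulrDr [a * (a^-1 * _)]mulrA divff ?gt_eqF //.
have := sqr_ge0 `|a *: u - v|.
rewrite sqr_normB normrZ gtr0_norm // linearZl_LR /=; lra.
Qed.

Lemma cauchy_schwarz u v : ip u v <= `|u| * `|v|.
Proof.
have [->|u0] := eqVneq u 0; first by rewrite linear0l normr0 mul0r.
have [->|v0] := eqVneq v 0; first by rewrite linear0r normr0 mulr0.
have nu : 0 < `|u| by rewrite normr_gt0.
have nv : 0 < `|v| by rewrite normr_gt0.
have := young u v (divr_gt0 nv nu).
have -> : `|v| / `|u| * `|u| ^+ 2 = `|u| * `|v| by field; rewrite gt_eqF.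
have -> : (`|v| / `|u|)^-1 * `|v| ^+ 2 = `|u| * `|v|.
  by field; rewrite ?gt_eqF.
lra.
Qed.

Lemma cvg_ip (T : Type) (F : set_system T) {FF : Filter F} (f g : T -> H) a b :
  f x @[x --> F] --> a -> g x @[x --> F] --> b ->
  ip (f x) (g x) @[x --> F] --> ip a b.
Proof.
move=> fa gb; rewrite polarization.
under eq_fun do rewrite polarization.
apply: cvgM; last exact: cvg_cst.
by apply: cvgB; apply: cvgM; apply: cvg_norm;
  [exact: cvgD|exact: cvgD|exact: cvgB|exact: cvgB].
Qed.

Lemma halfspace_closed (a : H) (c : R) : closed [set w | ip w a <= c].
Proof.
apply: (@preimage_closed _ _ (ip^~ a) [set r : R | r <= c]);
  last exact: closed_le.
by move=> w _; apply: cvg_ip; [exact: cvg_id|exact: cvg_cst].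
Qed.

Lemma halfspace_convex (a : H) (c : R) :
  convex_set ([set w | ip w a <= c] : set (convex_lmodType H)).
Proof.
apply/convex_setP => u v t t0 t1 /= uc vc.
rewrite linearDl /= !linearZl_LR /=; nra.
Qed.

(** * Nested convex sets, projections and weak cluster points *)

(** A form of weak compactness that needs no weak topology. Let d be the limit
    of the distances from a to the sets K_n. Points y_n of K_n whose distance to
    a exceeds d by less than 1/(n+1) form a Cauchy sequence: the midpoint of y_m
    and y_n is at distance at least almost d from a, and the parallelogram
    identity then forces y_m and y_n together. A constant sequence of sets gives the
    projection theorem. *)
Lemma nested_convex_closest (K : nat -> set H) (a : H) (B : R) :
  (forall n, closed (K n)) ->
  (forall n, convex_set (K n : set (convex_lmodType H))) ->
  (forall m n, (m <= n)%N -> K n `<=` K m) ->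
  (forall n, exists2 y, K n y & `|a - y| <= B) ->
  exists2 y, forall n, K n y &
    forall r, (forall n, exists2 w, K n w & `|a - w| <= r) -> `|a - y| <= r.
Proof.
move=> Kcl Kcv Kdec KB.
(* The supremum of T is the limit d of the distances from a to the K n. *)
pose T := [set r : R | exists n, forall y, K n y -> r <= `|a - y|].
have T0 : T 0 by exists 0%N.
have Tub r : (forall n, exists2 w, K n w & `|a - w| <= r) -> ubound T r.
  by move=> Kr s [n Ks]; have [w /Ks sw wr] := Kr n; exact: le_trans sw wr.
have Tsup : has_sup T by split; [exists 0|exists B; exact: Tub].
pose d := sup T.
have d0 : 0 <= d by exact: sup_upper_bound.
have near_d n (e : R) : 0 < e -> exists2 y, K n y & `|a - y| < d + e.
  move=> e0; apply: contrapT => nex.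
  suff : d + e <= d by lra.
  apply: sup_upper_bound => //; exists n => y Ky.
  by rewrite leNgt; apply/negP => ylt; apply: nex; exists y.
have far_d (e : R) : 0 < e -> exists n, forall y, K n y -> d - e < `|a - y|.
  move=> e0; have [r [n Kr] rd] := sup_adherent e0 Tsup.
  by exists n => y /Kr; exact: lt_le_trans.
have /choice[y yP] n : exists y, K n y /\ `|a - y| < d + n.+1%:R^-1.
  by have [|y] := near_d n n.+1%:R^-1; [rewrite invr_gt0|exists y].
have diam (e : R) : 0 < e -> exists N, forall m n, (N <= m)%N -> (N <= n)%N ->
    `|y m - y n| ^+ 2 < 16 * d * e + 4 * e ^+ 2.
  move=> e0; have [N1 KN1] := far_d e e0.
  have [N2 _ N2P] := near_infty_natSinv_lt (PosNum e0).
  exists (maxn N1 N2) => m n; rewrite !geq_max => /andP[m1 m2] /andP[n1 n2].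
  have [Km ym] := yP m; have [Kn yn] := yP n.
  have {}ym : `|a - y m| < d + e.
    by apply: lt_trans ym _; rewrite ltrD2l; exact: N2P m m2.
  have {}yn : `|a - y n| < d + e.
    by apply: lt_trans yn _; rewrite ltrD2l; exact: N2P n n2.
  have mid : K N1 (2^-1 *: y m + (1 - 2^-1) *: y n).
    by move/convex_setP : (Kcv N1); apply;
      [lra|lra|exact: Kdec Km|exact: Kdec Kn].
  have := KN1 _ mid.
  have -> : a - (2^-1 *: y m + (1 - 2^-1) *: y n) =
      2^-1 *: ((a - y m) + (a - y n)).
    have -> : 1 - 2^-1 = 2^-1 :> R by lra.
    rewrite [in RHS]addrACA -opprD -mulr2n -[a *+ 2]scaler_nat [in RHS]scalerBr.
    by rewrite scalerA mulVf ?pnatr_eq0 // scale1r scalerDr.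
  rewrite normrZ gtr0_norm ?invr_gt0 // => far.
  have -> : y m - y n = (a - y n) - (a - y m).
    by rewrite opprB [RHS]addrC subrKA.
  rewrite [ltLHS]sqr_normB ipC.
  have := sqr_normD (a - y m) (a - y n).
  have := normr_ge0 (a - y m); have := normr_ge0 (a - y n).
  move: far ym yn; move: `|_ + _| `|a - y m| `|a - y n| (ip _ _).
  move=> p q r s far qd rd r0 q0 pE.
  have q2 : q ^+ 2 < (d + e) ^+ 2 by rewrite ltr_pXn2r ?nnegrE //; lra.
  have r2 : r ^+ 2 < (d + e) ^+ 2 by rewrite ltr_pXn2r ?nnegrE //; lra.
  (* p^2 / 4 >= 2 d (p / 2) - d^2 holds whatever the sign of d - e, so
     the inequality p / 2 > d - e is never squared. *)
  have p2 : 4 * (d ^+ 2 - 2 * d * e) <= p ^+ 2.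
    have := sqr_ge0 (2^-1 * p - d); have : 0 <= d * (2^-1 * p - (d - e)).
      by rewrite mulr_ge0 // subr_ge0 ltW.
    nra.
  nra.
have ycvg : cvg (y @ \oo).
  apply/cauchy_cvgP/cauchy_exP => e e0.
  have [N diamN] : exists N, forall m n, (N <= m)%N -> (N <= n)%N ->
      `|y m - y n| ^+ 2 < e ^+ 2.
    (* With e' = e^2 / q, 16 d e' + 4 e'^2 <= e^2, as e' <= e. *)
    pose q := 16 * d + 4 * e + 1.
    have q0 : 0 < q by rewrite /q; lra.
    have e'0 : 0 < e ^+ 2 / q by rewrite divr_gt0 ?exprn_gt0.
    have e'e : e ^+ 2 / q <= e.
      by have := mulr_ge0 d0 (ltW e0); rewrite ler_pdivrMr // /q; nra.
    have e'E : q * (e ^+ 2 / q) = e ^+ 2 by rewrite mulrC divfK ?gt_eqF.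
    have [N NP] := diam _ e'0; exists N => m n mN nN.
    apply: lt_le_trans (NP m n mN nN) _; rewrite -[leRHS]e'E.
    move: (e ^+ 2 / q) e'0 e'e => e'; rewrite /q; nra.
  exists (y N); exists N => // n /= Nn; rewrite -ball_normE /=.
  by rewrite -(ltr_pXn2r (ltn0Sn 1)) ?nnegrE; [exact: diamN| |exact: ltW].
exists (lim (y @ \oo)).
  move=> n; apply: (closed_cvg _ (Kcl n) _ _ ycvg).
  by exists n => // m /= nm; apply: Kdec nm _ _; case: (yP m).
move=> r /Tub Tr; apply: le_trans (ge_sup _ Tr); last by exists 0.
apply/ler_addgt0Pr => e e0.
apply: (closed_cvg _ (@closed_le R (d + e)) _ _
  (cvg_norm (cvgB (cvg_cst a) ycvg))).
near=> n => /=; apply/ltW/(lt_le_trans (yP n).2); rewrite lerD2l ltW //.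
near: n; exact: near_infty_natSinv_lt (PosNum e0).
Unshelve. all: by end_near.
Qed.

Lemma metric_projP (M : set H) (x : H) :
  closed M -> convex_set (M : set (convex_lmodType H)) -> M !=set0 ->
  is_nearest_point M x (metric_proj M x).
Proof.
move=> Mcl Mcv [w Mw].
have [| |p Mp pP] := @nested_convex_closest (fun=> M) x `|x - w|
  (fun=> Mcl) (fun=> Mcv).
- by move=> m n _ y.
- by move=> _; exists w.
- apply: xgetPex; exists p; split; first exact: Mp 0%N.
  by move=> y My; apply: pP => _; exists y.
Qed.

(** Moving from p towards y by a small fraction t changes the squared distance
    to x by - 2 t (x - p, y - p) + O(t^2), which cannot be negative. *)
Lemma nearest_point_obtuse (M : set H) (x p : H) :
  convex_set (M : set (convex_lmodType H)) -> is_nearest_point M x p ->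
  forall y, M y -> ip (x - p) (y - p) <= 0.
Proof.
move=> /convex_setP Mcv [Mp pmin] y My; rewrite leNgt; apply/negP => c0.
set c := ip _ _ in c0; set q := `|y - p| ^+ 2.
have q0 : 0 <= q by exact: sqr_ge0.
have cq0 : 0 < c + q by lra.
(* Then t <= 1 and t^2 q = t c - t^2 c < 2 t c. *)
pose t := c / (c + q).
have t0 : 0 < t by rewrite divr_gt0.
have t1 : t <= 1 by rewrite ler_pdivrMr //; lra.
have tcq : t * (c + q) = c by rewrite divfK ?gt_eqF.
have := pmin _ (Mcv y p t (ltW t0) t1 My Mp).
rewrite -(ler_pXn2r (ltn0Sn 1)) ?nnegrE //.
have -> : x - (t *: y + (1 - t) *: p) = (x - p) - t *: (y - p).
  rewrite scalerBl scale1r scalerBr addrCA [in RHS]opprB -addrA opprD.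
  by rewrite -opprB opprB.
rewrite [leRHS]sqr_normB linearZr_LR /= -/c normrZ gtr0_norm // exprMn -/q.
have -> : t ^+ 2 * q = t * (t * (c + q)) - t ^+ 2 * c by ring.
rewrite tcq.
have := mulr_gt0 t0 c0; have := mulr_ge0 (sqr_ge0 t) (ltW c0); lra.
Qed.

(** Stands for a weak cluster point of the terms u_n with P n: by Mazur, a weak
    limit lies in the closed convex hull of every tail, and a common point of
    these hulls inherits every closed convex condition that the terms eventually
    meet. *)
Lemma weak_cluster_point (u : nat -> H) (P : nat -> Prop) (B : R) :
  (forall n, P n -> `|u n| <= B) ->
  (forall N, exists2 n, (N <= n)%N & P n) ->
  exists y, forall M : set H, closed M ->
    convex_set (M : set (convex_lmodType H)) ->
    (\forall n \near \oo, P n -> M (u n)) -> M y.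
Proof.
move=> uB Pfreq.
(* K N is the closed convex hull of the terms of index at least N. *)
pose K N := [set y | forall M : set H, closed M ->
  convex_set (M : set (convex_lmodType H)) ->
  (forall n, (N <= n)%N -> P n -> M (u n)) -> M y].
have [| | | |y Ky _] := @nested_convex_closest K 0 B.
- move=> N y yK M Mcl Mcv MP; suff : closure M y by exact: Mcl.
  move=> V /yK [w [Kw Vw]].
  by exists w; split => //; exact: Kw.
- move=> N; apply/convex_setP => v w t t0 t1 Kv Kw M Mcl Mcv MP.
  by move/convex_setP : (Mcv); apply => //; [exact: Kv|exact: Kw].
- move=> m n mn y Ky M Mcl Mcv MP; apply: Ky => // i ni.
  by apply: MP; exact: leq_trans ni.
- move=> N; have [n Nn Pn] := Pfreq N.
  by exists (u n); [move=> M _ _; exact|rewrite sub0r normrN uB].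
by exists y => M Mcl Mcv [N _ MP]; apply: (Ky N).
Qed.

(** * Minty's form of the variational inequality *)

(** Apply the hypothesis at w = y + t (v - y), divide by t, and let t tend to 0:
    by the Lipschitz bound A w may be replaced by A y up to O(t). Here one value
    of t that already contradicts (A y, v - y) < 0 is used. *)
Lemma minty (C : set H) (A : H -> H) (L : R) (y : H) :
  convex_set (C : set (convex_lmodType H)) ->
  (forall u v, C u -> C v -> `|A u - A v| <= L * `|u - v|) ->
  C y -> (forall u, C u -> 0 <= ip (A u) (u - y)) -> vi_solutions ip C A y.
Proof.
move=> /convex_setP Ccv Alip Cy Ay; split => // v Cv.
rewrite leNgt; apply/negP => c0.
set c := ip _ _ in c0; pose q := `|L| * `|v - y| ^+ 2.
have q0 : 0 <= q by rewrite mulr_ge0 ?sqr_ge0.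
have cq0 : 0 < q - c by lra.
(* Then t <= 1 and c + t q = t c < 0; t q bounds the cost of passing from A w
   to A y. *)
pose t := - c / (q - c).
have t0 : 0 < t by rewrite divr_gt0 //; lra.
have t1 : t <= 1 by rewrite ler_pdivrMr //; lra.
have tcq : t * (q - c) = - c by rewrite divfK ?gt_eqF.
have Cw := Ccv v y t (ltW t0) t1 Cv Cy.
set w := t *: v + _ in Cw.
have wy : w - y = t *: (v - y).
  by rewrite /w scalerBl scale1r addrA addrAC addrK -scalerBr.
have := Ay w Cw; rewrite wy linearZr_LR /= pmulr_rge0 //.
have := cauchy_schwarz (A w - A y) (v - y); rewrite linearBl /= -/c.
have : `|A w - A y| * `|v - y| <= t * q.
  have -> : t * q = (`|L| * `|w - y|) * `|v - y|.
    by rewrite wy normrZ gtr0_norm // /q expr2; ring.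
  rewrite ler_wpM2r //; apply: le_trans (Alip w y Cw Cy) _.
  by rewrite ler_wpM2r // ler_norm.
nra.
Qed.

Section Solutions.
Context (C : set H) (C_closed : closed C).
Context (C_convex : convex_set (C : set (convex_lmodType H))).
Context (A : H -> H).
Context (A_monotone : forall x y, C x -> C y -> 0 <= ip (A x - A y) (x - y)).
Context (L : R).
Context (A_lipschitz : forall x y, C x -> C y -> `|A x - A y| <= L * `|x - y|).

(** Unlike the definition, Minty's form is affine in y, hence a family of
    half-space conditions: this is what makes the solution set closed and convex,
    and what passes to weak cluster points. *)
Lemma vi_solutionsP (y : H) :
  vi_solutions ip C A y <-> C y /\ forall u, C u -> 0 <= ip (A u) (u - y).
Proof.
split=> [[Cy Ay]|[Cy yA]]; last exact: minty A_lipschitz _ _.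
split => // u Cu.
have := A_monotone Cu Cy; have := Ay _ Cu.
by rewrite linearBl /=; lra.
Qed.

Lemma minty_halfspaceE (u : H) (c : R) :
  [set y | - c <= ip (A u) (u - y)] = [set y | ip y (A u) <= ip u (A u) + c].
Proof.
apply/seteqP; split => y /=; rewrite linearBr /= (ipC u) (ipC y); lra.
Qed.

Lemma vi_solutions_closed : closed (vi_solutions ip C A).
Proof.
move=> y ySc; apply/vi_solutionsP; split.
  by apply: C_closed; apply: closureS ySc => w [].
move=> u Cu; rewrite -oppr0.
suff : [set y | - 0 <= ip (A u) (u - y)] y by [].
rewrite minty_halfspaceE; apply: (halfspace_closed (c := ip u (A u) + 0)).
apply: closureS ySc => w /vi_solutionsP[_ /(_ _ Cu)].
by rewrite -minty_halfspaceE /= oppr0.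
Qed.

Lemma vi_solutions_convex :
  convex_set (vi_solutions ip C A : set (convex_lmodType H)).
Proof.
apply/convex_setP => v w t t0 t1 /vi_solutionsP[Cv Av].
move=> /vi_solutionsP[Cw Aw]; apply/vi_solutionsP; split.
  by move/convex_setP : C_convex; apply.
move=> u Cu; rewrite -oppr0.
suff : [set y | - 0 <= ip (A u) (u - y)] (t *: v + (1 - t) *: w) by [].
rewrite minty_halfspaceE.
have /convex_setP := @halfspace_convex (A u) (ip u (A u) + 0).
by apply => //; rewrite -minty_halfspaceE /= oppr0; [exact: Av|exact: Aw].
Qed.
End Solutions.

(** * Vanishing sequences *)

Lemma summable_decrease_cvg0 (W e : nat -> R) (c : R) :
  (forall n, 0 <= e n) -> (forall n, e n <= W n - W n.+1) ->
  (forall n, c <= W n) -> e @ \oo --> 0.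
Proof.
move=> e0 eW Wc.
have Wdec n : W n.+1 <= W n by rewrite -subr_ge0; exact: le_trans (eW n).
have Wcvg : cvg (W @ \oo).
  apply: nonincreasing_is_cvgn; last by exists c => _ [n _ <-].
  by apply/nonincreasing_seqP.
apply: (@squeeze_cvgr _ _ _ _ (fun=> 0) (fun n => W n - W n.+1)).
- by near=> n; rewrite e0 eW.
- exact: cvg_cst.
- by rewrite -(subrr (lim (W @ \oo))); apply: cvgB => //; rewrite cvg_shiftS.
Unshelve. all: by end_near.
Qed.

Lemma cvg0_sqr_norm (u : nat -> H) :
  (fun n => `|u n| ^+ 2) @ \oo --> (0 : R) -> u @ \oo --> (0 : H).
Proof.
move=> /cvgrPdist_lt u2; apply/cvgrPdist_lt => e e0.
near=> n; rewrite sub0r normrN -(ltr_pXn2r (ltn0Sn 1)) ?nnegrE ?(ltW e0) //.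
have : `|0 - `|u n| ^+ 2| < e ^+ 2 by near: n; apply: u2; rewrite exprn_gt0.
by rewrite sub0r normrN ger0_norm // exprn_ge0.
Unshelve. all: by end_near.
Qed.

Lemma cvg_ip0 (f g : nat -> H) (B : R) :
  f @ \oo --> (0 : H) -> (\forall n \near \oo, `|g n| <= B) ->
  (fun n => ip (f n) (g n)) @ \oo --> (0 : R).
Proof.
move=> f0 gB.
have fB : (fun n => `|f n| * B) @ \oo --> (0 : R).
  rewrite -(mul0r B) -(normr0 H); apply: cvgM; last exact: cvg_cst.
  exact: cvg_norm.
apply: (@squeeze_cvgr _ _ _ _ (fun n => - (`|f n| * B))
  (fun n => `|f n| * B)) => //.
- near=> n.
  have gn : `|g n| <= B by near: n.
  have fg : `|f n| * `|g n| <= `|f n| * B by rewrite ler_wpM2l.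
  have := cauchy_schwarz (f n) (g n); have := cauchy_schwarz (- f n) (g n).
  rewrite linearNl normrN /=; lra.
- by rewrite -(oppr0 R); exact: cvgN.
Unshelve. all: by end_near.
Qed.

(** * The half-space cuts *)

(** The reason why solutions lie in the cuts [hybrid_C]; here xm, x1 are
    consecutive iterates x, and zm, z1, z2 consecutive iterates z. The obtuse angle at z2,
    tested on s, and monotonicity give
    |z2 - s|^2 <= |x1 - s|^2 - |x1 - z2|^2 - 2 lambda (A z1, z2 - z1).
    Expanding |x1 - z2|^2 around z1 leaves 2 (x1 - lambda A z1 - z1, z2 - z1);
    the obtuse angle at z1, tested on z2, bounds (xm - z1, z2 - z1) by
    lambda (A zm, z2 - z1), and Young's inequality bounds what is left,
    2 (x1 - xm, z2 - z1) with weight k and 2 lambda (A zm - A z1, z2 - z1) with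
    weight 1 / L. *)
Lemma projection_step_estimate (C : set H) (A : H -> H) (L lambda k : R)
    (zm z1 z2 xm x1 s : H) :
  convex_set (C : set (convex_lmodType H)) ->
  (forall u v, C u -> C v -> 0 <= ip (A u - A v) (u - v)) ->
  (forall u v, C u -> C v -> `|A u - A v| <= L * `|u - v|) ->
  0 < L -> 0 < lambda -> 0 < k -> C zm ->
  is_nearest_point C (xm - lambda *: A zm) z1 ->
  is_nearest_point C (x1 - lambda *: A z1) z2 ->
  vi_solutions ip C A s ->
  `|z2 - s| ^+ 2 <= `|x1 - s| ^+ 2 + k * `|x1 - xm| ^+ 2
    - (1 - 1 / k - lambda * L) * `|z2 - z1| ^+ 2
    + lambda * L * `|z1 - zm| ^+ 2.
Proof.
move=> Ccv Amono Alip L0 l0 k0 Cm n1 n2 [Cs As].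
have C1 : C z1 by case: n1.
have C2 : C z2 by case: n2.
have o1 := nearest_point_obtuse Ccv n1 C2.
have o2 := nearest_point_obtuse Ccv n2 Cs.
have pos : 0 <= lambda * ip (A z1) (z1 - s).
  rewrite mulr_ge0 ?(ltW l0) //; have := Amono _ _ C1 Cs; have := As _ C1.
  by rewrite linearBl /=; lra.
have y1 := young (x1 - xm) (z2 - z1) k0.
have y2 : 2 * (lambda * ip (A zm - A z1) (z2 - z1)) <=
    lambda * L * `|z1 - zm| ^+ 2 + lambda * L * `|z2 - z1| ^+ 2.
  rewrite mulrCA -!mulrA -mulrDr ler_pM2l //.
  have iL : 0 < L^-1 by rewrite invr_gt0.
  apply: le_trans (young _ _ iL) _; rewrite invrK lerD2r ler_pdivrMl //.
  rewrite mulrA -expr2 -exprMn ler_pXn2r ?nnegrE ?mulr_ge0 ?(ltW L0) //.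
  by rewrite (distrC z1); exact: Alip.
rewrite div1r.
set r1 := lambda * L * _ in y2 *.
set r2 := lambda * L * _ in y2.
have -> : (1 - k^-1 - lambda * L) * `|z2 - z1| ^+ 2 =
  `|z2 - z1| ^+ 2 - k^-1 * `|z2 - z1| ^+ 2 - r2 by rewrite /r2; ring.
move: y1 y2; move: (k * _) (k^-1 * _) (r1) (r2) => {r1 r2}a b r1 r2.
move: o1 o2 pos (sqr_ge0 `|x1 - z1|).
rewrite !sqr_normB !sqr_norm !(linearBl, linearBr, linearZl_LR) /=.
rewrite ?(ipC s x1, ipC s z1, ipC s z2, ipC z2 x1, ipC z2 xm, ipC z2 z1).
rewrite ?(ipC z1 xm, ipC z1 x1, ipC x1 xm).
lra.
Qed.

(** The quadratic terms in w cancel between the two sides. *)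
Lemma hybrid_CS_halfspace (L lambda k : R) (x z : nat -> H) (n : nat) :
  exists a c, hybrid_C L lambda k x z n.+1 = [set w | ip w a <= c].
Proof.
pose e := k * `|x n.+1 - x n| ^+ 2
  - (1 - 1 / k - lambda * L) * `|z n.+2 - z n.+1| ^+ 2
  + lambda * L * `|z n.+1 - z n| ^+ 2.
exists (2 *: (x n.+1 - z n.+2)), (`|x n.+1| ^+ 2 - `|z n.+2| ^+ 2 + e).
apply/seteqP; split => w /=; rewrite /e !(sqr_normB _ w) linearZr_LR;
  rewrite linearBr /= (ipC w) (ipC w); lra.
Qed.

Lemma hybrid_QS_halfspace (x : nat -> H) (n : nat) :
  hybrid_Q ip x n.+1 =
  [set w | ip w (x 0%N - x n.+1) <= ip (x n.+1) (x 0%N - x n.+1)].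
Proof. by apply/seteqP; split => w /=; rewrite linearBl subr_ge0. Qed.

Lemma hybrid_cuts_closed (L lambda k : R) (x z : nat -> H) (n : nat) :
  closed (hybrid_C L lambda k x z n `&` hybrid_Q ip x n).
Proof.
case: n => [|n]; first by rewrite setIT; exact: closedT.
have [a [c ->]] := hybrid_CS_halfspace L lambda k x z n.
by rewrite hybrid_QS_halfspace; apply: closedI; exact: halfspace_closed.
Qed.

Lemma hybrid_cuts_convex (L lambda k : R) (x z : nat -> H) (n : nat) :
  convex_set (hybrid_C L lambda k x z n `&` hybrid_Q ip x n
    : set (convex_lmodType H)).
Proof.
apply/convex_setP => u v t t0 t1.
case: n => [//|n].
have [a [c ->]] := hybrid_CS_halfspace L lambda k x z n.
rewrite hybrid_QS_halfspace => -[u1 u2] [v1 v2].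
split; last first.
  by move/convex_setP : (@halfspace_convex (x 0%N - x n.+1)
    (ip (x n.+1) (x 0%N - x n.+1))); apply.
by move/convex_setP : (@halfspace_convex a c); apply.
Qed.

(** * Convergence of the hybrid algorithm *)

Section HybridRun.
Context (C : set H) (C_closed : closed C).
Context (C_convex : convex_set (C : set (convex_lmodType H))).
Context (A : H -> H).
Context (A_monotone : forall x y, C x -> C y -> 0 <= ip (A x - A y) (x - y)).
Context (L : R) (L_gt0 : 0 < L).
Context (A_lipschitz : forall x y, C x -> C y -> `|A x - A y| <= L * `|x - y|).
Context (lambda : R) (lambda_gt0 : 0 < lambda).
Context (k : R) (k_gt0 : 0 < k) (k_gt : lambda * L < 1 - k^-1 - lambda * L).
Context (x0 z0 : H) (x0_C : C x0) (z0_C : C z0) (x z : nat -> H).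
Context (run : hybrid_run ip C A L lambda k x0 z0 x z).

Let x0E : x 0%N = x0. Proof. exact: run_x0 run. Qed.

Lemma run_z_nearest n : is_nearest_point C (x n - lambda *: A (z n)) (z n.+1).
Proof. by rewrite (run_z run); apply: metric_projP => //; exists x0. Qed.

Lemma run_z_in n : C (z n).
Proof.
case: n => [|n]; first by rewrite (run_z0 run).
by case: (run_z_nearest n).
Qed.

Lemma solution_hybrid_C n s :
  vi_solutions ip C A s -> hybrid_C L lambda k x z n s.
Proof.
case: n => [//|n] Ss.
exact: (projection_step_estimate C_convex A_monotone A_lipschitz L_gt0
  lambda_gt0 k_gt0 (run_z_in n) (run_z_nearest n) (run_z_nearest n.+1) Ss).
Qed.

Context (s : H) (Ss : vi_solutions ip C A s).

(** Conditional form, used inside the induction that removes its hypothesis. *)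
Lemma run_x_nearestW n : hybrid_Q ip x n s ->
  is_nearest_point (hybrid_C L lambda k x z n `&` hybrid_Q ip x n) x0 (x n.+1).
Proof.
move=> Qs; rewrite (run_x run); apply: metric_projP.
- exact: hybrid_cuts_closed.
- exact: hybrid_cuts_convex.
- by exists s; split => //; exact: solution_hybrid_C.
Qed.

Lemma solution_hybrid_Q n : hybrid_Q ip x n s.
Proof.
elim: n => [//|n IHn] /=.
have := nearest_point_obtuse (@hybrid_cuts_convex L lambda k x z n)
  (run_x_nearestW IHn).
move=> /(_ s (conj (solution_hybrid_C n Ss) IHn)).
by rewrite x0E ipC !linearBl !linearBr /=; lra.
Qed.

Lemma run_x_nearest n :
  is_nearest_point (hybrid_C L lambda k x z n `&` hybrid_Q ip x n) x0 (x n.+1).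
Proof. exact/run_x_nearestW/solution_hybrid_Q. Qed.

Lemma run_x_dist_le n : `|x0 - x n| <= `|x0 - s|.
Proof.
case: n => [|n]; first by rewrite x0E subrr normr0.
have [_] := run_x_nearest n; apply; split; first exact: solution_hybrid_C.
exact: solution_hybrid_Q.
Qed.

Lemma run_x_increment n :
  `|x n - x n.+1| ^+ 2 <= `|x0 - x n.+1| ^+ 2 - `|x0 - x n| ^+ 2.
Proof.
have : 0 <= ip (x n - x n.+1) (x0 - x n).
  case: n => [|n]; first by rewrite x0E subrr linear0r.
  by have [[_ /=]] := run_x_nearest n.+1; rewrite x0E.
rewrite !sqr_normB !sqr_norm !linearBl !linearBr /=.
rewrite (ipC (x n.+1) x0) (ipC (x n) x0) (ipC (x n.+1) (x n)); lra.
Qed.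

(** With D n = |x0 - x n|^2 and b n = |z n.+1 - z n|^2, the energy
    W n = lambda L b n - D n.+1 - k D n is bounded below, and x n.+2 lying in
    the cut [hybrid_C] of index n.+1 says that
    g b n.+1 + |z n.+2 - x n.+2|^2 <= W n - W n.+1,
    where g = 1 - 1/k - 2 lambda L > 0 by the choice of k. *)
Lemma run_increments_cvg0 :
  (fun n => z n.+1 - z n) @ \oo --> (0 : H) /\
  (fun n => z n - x n) @ \oo --> (0 : H).
Proof.
pose D n := `|x0 - x n| ^+ 2.
pose b n := `|z n.+1 - z n| ^+ 2.
pose W n := lambda * L * b n - D n.+1 - k * D n.
have lL : 0 < lambda * L by rewrite mulr_gt0.
pose g := 1 - k^-1 - lambda * L - lambda * L.
have g0 : 0 < g by rewrite subr_gt0.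
have key n : g * b n.+1 + `|z n.+2 - x n.+2| ^+ 2 <= W n - W n.+1.
  have [[/= + _] _] := run_x_nearest n.+1.
  rewrite div1r -/(b n) -/(b n.+1).
  have := run_x_increment n.+1.
  have := ler_wpM2l (ltW k_gt0) (run_x_increment n).
  rewrite /W /g -/(D n) -/(D n.+1) -/(D n.+2) (distrC (x n.+1) (x n)); lra.
have b0 n : 0 <= g * b n.+1 by rewrite mulr_ge0 ?sqr_ge0 // ltW.
have zx0 n : 0 <= `|z n.+2 - x n.+2| ^+ 2 by exact: sqr_ge0.
have Dle n : D n <= `|x0 - s| ^+ 2.
  by rewrite /D ler_pXn2r ?nnegrE //; exact: run_x_dist_le.
have Wlb n : - `|x0 - s| ^+ 2 - k * `|x0 - s| ^+ 2 <= W n.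
  have := ler_wpM2l (ltW k_gt0) (Dle n); have := Dle n.+1.
  have : 0 <= lambda * L * b n by rewrite mulr_ge0 ?sqr_ge0 // ltW.
  rewrite /W; lra.
split; apply: cvg0_sqr_norm.
- have : (fun n => g * b n.+1) @ \oo --> (0 : R).
    by apply: summable_decrease_cvg0 b0 _ Wlb => n;
      have := key n; have := zx0 n; lra.
  move=> gb; rewrite -cvg_shiftS.
  rewrite (_ : [sequence _]_n = (fun n => g^-1 * (g * b n.+1))); last first.
    by apply/funext => n; rewrite mulKf // gt_eqF.
  have := cvgM (cvg_cst g^-1) gb; rewrite mulr0; exact.
- rewrite -cvg_shiftS -cvg_shiftS.
  by apply: summable_decrease_cvg0 zx0 _ Wlb => n;
    have := key n; have := b0 n; lra.
Qed.

Lemma run_z_bounded : exists B, \forall n \near \oo, `|z n| <= B.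
Proof.
exists (1 + (`|x0 - s| + `|x0|)).
have [_ /cvgrPdist_le/(_ 1 ltr01) zx] := run_increments_cvg0.
near=> n.
have -> : z n = (z n - x n) - (x0 - x n) + x0 by rewrite opprB subrKA subrK.
rewrite (le_trans (ler_normD _ _)) // addrA lerD2r.
rewrite (le_trans (ler_normB _ _)) //.
rewrite lerD ?run_x_dist_le // -normrN -sub0r.
by near: n.
Unshelve. all: by end_near.
Qed.

(** The obtuse angle at z n.+1 gives
    lambda (A (z n), u - z n.+1) >= (x n - z n.+1, u - z n.+1), and monotonicity
    replaces A (z n) by A u. All error terms pair a vanishing sequence with a
    bounded one. *)
Lemma run_z_minty u e : C u -> 0 < e ->
  \forall n \near \oo, - e <= ip (A u) (u - z n).
Proof.
move=> Cu e0.
have [dz zx] := run_increments_cvg0.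
have [B zB] := run_z_bounded.
pose g n := lambda^-1 * ip (x n - z n.+1) (u - z n.+1)
  + ip (z n.+1 - z n) (A (z n)).
have xz : (fun n => x n - z n.+1) @ \oo --> (0 : H).
  have -> : (fun n => x n - z n.+1) = (fun n => - (z n.+1 - z n) - (z n - x n)).
    by apply/funext => n; rewrite !opprB [RHS]addrC subrKA.
  by rewrite -(subrr 0) -[X in X - _]oppr0; apply: cvgB => //; exact: cvgN.
have g0 : g @ \oo --> (0 : R).
  rewrite -(addr0 0) -[X in X + _](mulr0 lambda^-1); apply: cvgD.
    apply: cvgM; first exact: cvg_cst.
    apply: (@cvg_ip0 _ _ (`|u| + B)) => //.
    have zB1 : \forall n \near \oo, `|z n.+1| <= B.
      by case: zB => N _ NB; exists N => // n Nn; apply: NB; exact: leqW.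
    near=> n; rewrite (le_trans (ler_normB _ _)) // lerD2l.
    by near: n.
  apply: (@cvg_ip0 _ _ (`|A u| + L * (B + `|u|))) => //.
  near=> n.
  have -> : A (z n) = A u + (A (z n) - A u) by rewrite addrC subrK.
  rewrite (le_trans (ler_normD _ _)) // lerD2l.
  rewrite (le_trans (A_lipschitz (run_z_in n) Cu)) // ler_pM2l //.
  rewrite (le_trans (ler_normB _ _)) // lerD2r.
  by near: n.
move/cvgrPdist_le : g0 => /(_ e e0) ge.
near=> n.
have gn : `|0 - g n| <= e by near: n.
have {}gn : - e <= g n by move: gn; rewrite sub0r normrN ler_norml => /andP[].
apply: le_trans gn _.
have := A_monotone Cu (run_z_in n).
have := nearest_point_obtuse C_convex (run_z_nearest n) Cu.
rewrite [ip _ (u - z n)]linearBl addrAC [ip _ (u - z n.+1)]linearBl /=.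
rewrite linearZl_LR /= subr_le0.
rewrite subr_ge0 => h mon; apply: le_trans mon.
rewrite /g addrC -lerBrDl ler_pdivrMl //; apply: le_trans h _.
by rewrite ler_pM2l // (ipC _ (A (z n))) -linearBr /= opprB addrA subrK.
Unshelve. all: by end_near.
Qed.

Context (s_nearest : is_nearest_point (vi_solutions ip C A) x0 s).

(** Otherwise the z n with (z n - s, x0 - s) >= e have a weak cluster point y,
    which solves the variational inequality and keeps (y - s, x0 - s) >= e; this
    contradicts the obtuse angle at the projection s of x0 on the solution set. *)
Lemma run_z_limsup_obtuse e : 0 < e ->
  \forall n \near \oo, ip (z n - s) (x0 - s) < e.
Proof.
move=> e0; apply: contrapT => nlt.
have [B zB] := run_z_bounded.
pose P n := e <= ip (z n - s) (x0 - s) /\ `|z n| <= B.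
have Pfreq N : exists2 n, (N <= n)%N & P n.
  apply: contrapT => nP; apply: nlt; near=> n.
  rewrite ltNge; apply/negP => le_e; apply: nP; exists n.
    by near: n; exact: nbhs_infty_ge.
  by split => //; near: n.
have [y yM] : exists y, forall M : set H, closed M ->
    convex_set (M : set (convex_lmodType H)) ->
    (\forall n \near \oo, P n -> M (z n)) -> M y.
  by apply: (weak_cluster_point (B := B)) => // n [].
have Sy : vi_solutions ip C A y.
  apply/(vi_solutionsP C_convex A_monotone A_lipschitz); split.
    apply: yM => //; near=> n => _.
    exact: run_z_in.
  move=> u Cu; apply/ler_addgt0Pr => d d0; rewrite -lerBlDr sub0r.
  suff : [set w | - d <= ip (A u) (u - w)] y by [].
  apply: yM.
  - by rewrite minty_halfspaceE; exact: halfspace_closed.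
  - by rewrite minty_halfspaceE; exact: halfspace_convex.
  - near=> n => _ /=; near: n.
    exact: run_z_minty.
have := nearest_point_obtuse
  (vi_solutions_convex C_convex A_monotone A_lipschitz) s_nearest Sy.
rewrite ipC leNgt => /negP; apply; apply: lt_le_trans e0 _.
suff : [set w | ip w (s - x0) <= ip s (s - x0) - e] y.
  rewrite /= !linearBl !linearBr /=; lra.
apply: yM; [exact: halfspace_closed|exact: halfspace_convex|].
near=> n => -[]; rewrite /= !linearBl !linearBr /=; lra.
Unshelve. all: by end_near.
Qed.

(** As |x0 - x n| <= |x0 - s|, expanding around s gives
    |x n - s|^2 <= 2 (x n - s, x0 - s), and x n may be replaced by z n. *)
Lemma run_x_cvg : x @ \oo --> s.
Proof.
have [_ zx] := run_increments_cvg0.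
have zx0 : (fun n => ip (z n - x n) (x0 - s)) @ \oo --> (0 : R).
  by apply: (@cvg_ip0 _ _ `|x0 - s|) => //; near=> n.
suff xp0 : (fun n => x n - s) @ \oo --> (0 : H).
  rewrite (_ : x = (fun n => (x n - s) + s));
    last by apply/funext => n; rewrite subrK.
  by rewrite -[X in _ --> X]add0r; apply: cvgD => //; exact: cvg_cst.
apply: cvg0_sqr_norm; apply/cvgrPdist_le => e e0.
have e4 : 0 < e / 4 by rewrite divr_gt0.
near=> n.
rewrite sub0r normrN ger0_norm ?sqr_ge0 //.
have zp : ip (z n - s) (x0 - s) < e / 4 by near: n; exact: run_z_limsup_obtuse.
have xz : `|0 - ip (z n - x n) (x0 - s)| <= e / 4.
  by near: n; move/cvgrPdist_le : zx0; exact.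
have {}xz : - (e / 4) <= ip (z n - x n) (x0 - s).
  by move: xz; rewrite sub0r normrN ler_norml => /andP[].
have := run_x_dist_le n.
rewrite -(ler_pXn2r (ltn0Sn 1)) ?nnegrE //.
move: zp xz; rewrite !sqr_normB !sqr_norm !linearBl !linearBr /=.
rewrite ?(ipC (x n) x0, ipC s x0, ipC s (x n)); lra.
Unshelve. all: by end_near.
Qed.

Lemma run_z_cvg : z @ \oo --> s.
Proof.
have [_ zx] := run_increments_cvg0.
rewrite (_ : z = (fun n => (z n - x n) + x n));
  last by apply/funext => n; rewrite subrK.
by rewrite -[X in _ --> X]add0r; apply: cvgD => //; exact: run_x_cvg.
Qed.

End HybridRun.
End InnerProduct.

Theorem theorem1 (R : realType) (H : completeNormedModType R)
    (ip : {dot H for idfun}) (ip_norm : induces_norm ip)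
    (C : set H) (C_closed : closed C)
    (C_convex : convex_set (C : set (convex_lmodType H)))
    (A : H -> H)
    (S_nonempty : vi_solutions ip C A !=set0)
    (A_monotone : forall x y, C x -> C y -> 0 <= ip (A x - A y) (x - y))
    (L : R) (L_gt0 : 0 < L)
    (A_lipschitz : forall x y, C x -> C y -> `|A x - A y| <= L * `|x - y|)
    (lambda : R) (lambda_gt0 : 0 < lambda) (lambda_lt : lambda < 1 / (2 * L))
    (k : R) (k_gt : 1 / (1 - 2 * lambda * L) < k)
    (x0 z0 : H) (x0_C : C x0) (z0_C : C z0) (x z : nat -> H)
    (run : hybrid_run ip C A L lambda k x0 z0 x z) :
  (x @ \oo --> metric_proj (vi_solutions ip C A) x0) /\
  (z @ \oo --> metric_proj (vi_solutions ip C A) x0).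
Proof.
have lL : 0 < 1 - 2 * lambda * L.
  move: lambda_lt; rewrite ltr_pdivlMr ?mulr_gt0 //; lra.
have k_gt0 : 0 < k by apply: lt_trans k_gt; rewrite divr_gt0.
have kV : lambda * L < 1 - k^-1 - lambda * L.
  have : k^-1 < 1 - 2 * lambda * L.
    by move: k_gt; rewrite div1r -ltf_pV2 ?posrE ?invr_gt0 // invrK.
  rewrite -subr_gt0 -[in X in _ -> X]subr_gt0.
  by congr (0 < _); ring.
have pP := metric_projP ip_norm x0
  (vi_solutions_closed ip_norm C_closed C_convex A_monotone A_lipschitz)
  (vi_solutions_convex ip_norm C_convex A_monotone A_lipschitz) S_nonempty.
split.
- exact: (run_x_cvg ip_norm C_closed C_convex A_monotone L_gt0 A_lipschitz
    lambda_gt0 k_gt0 kV x0_C z0_C run (proj1 pP) pP).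
- exact: (run_z_cvg ip_norm C_closed C_convex A_monotone L_gt0 A_lipschitz
    lambda_gt0 k_gt0 kV x0_C z0_C run (proj1 pP) pP).
Qed.
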